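(* Let $R$ be a ring, $G$ a positive monoid, and $R[G]$ the monoid ring of $G$ over $R$. Then $R$ is right $\mathfrak{cP}$-Baer if and only if $R[G]$ is right $\mathfrak{cP}$-Baer.
   Context: All rings are associative with identity (not necessarily commutative). For a subset $S$ of a ring $R$, $r_R(S)=\{a\in R : sa=0 \text{ for all } s\in S\}$. A ring $R$ is right $\mathfrak{cP}$-Baer if for every idempotent $e=e^2\in R$ there is an idempotent $c=c^2\in R$ with $r_R(eR)=cR$. A monoid $G$ is ordered if its elements are linearly (totally) ordered by a relation $<$ such that for all $g,h,s\in G$, $g<h$ implies $sg<sh$ and $gs<hs$. An ordered monoid $G$ with identity $\mu$ is called positive if $\mu\le g$ for every $g\in G$. *)

(* Defs.v *)
From HB Require Import structures.
From mathcomp Require Import all_boot all_order all_algebra.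
From mathcomp Require Import finmap.
From mathcomp Require Import classical_sets.
From mathcomp Require Import monalg.

Set Implicit Arguments.
Unset Strict Implicit.
Unset Printing Implicit Defensive.

Import GRing.Theory.

Local Open Scope ring_scope.

Definition right_annihilator (R : pzRingType) (S : set R) : set R :=
  [set a | forall s, S s -> s * a = 0]%classic.

Definition principal_right_ideal (R : pzRingType) (x : R) : set R :=
  range (fun r : R => x * r).

Definition right_cP_Baer (R : pzRingType) : Prop :=
  forall e : R, e * e = e ->
    exists c : R, c * c = c /\
      right_annihilator (principal_right_ideal e) = principal_right_ideal c.

HB.mixin Record Monoid_isOrdered (d : Order.disp_t) (G : Type)
    of Monoid G & Order.Total d G := {
  ltgM2l : forall s g h : G, (g < h)%O -> (s * g < s * h)%O%g;
  ltgM2r : forall s g h : G, (g < h)%O -> (g * s < h * s)%O%g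
}.

#[short(type="orderedMonoidType")]
HB.structure Definition OrderedMonoid (d : Order.disp_t) :=
  { G of Monoid G & Order.Total d G & Monoid_isOrdered d G }.

HB.mixin Record OrderedMonoid_isPositive (d : Order.disp_t) (G : Type)
    of OrderedMonoid d G := {
  le1g : forall g : G, (1%g <= g)%O
}.

#[short(type="positiveMonoidType")]
HB.structure Definition PositiveMonoid (d : Order.disp_t) :=
  { G of OrderedMonoid d G & OrderedMonoid_isPositive d G }.

(* [monalg] puts a ring structure on [{malg R[G]}] only for a nonzero ring R  *)
(* and a [monomType] G, i.e., a monoid in which [x * y = 1] forces            *)
(* [x = y = 1]. The alias below shares its carrier and additive group (the    *)
(* finitely supported functions G -> R) and has the same product, for an      *)
(* arbitrary ring and an arbitrary monoid.                                    *)
Definition monoid_ring (R : pzRingType) (G : monoidType) : Type := {malg R[G]}.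

Section MonoidRing.
Variables (R : pzRingType) (G : monoidType).

HB.instance Definition _ := GRing.Zmodule.on (monoid_ring R G).

Implicit Types (f g : {malg R[G]}) (k : G).

Definition mring_one : {malg R[G]} := << 1 *g 1%g >>.

Definition mring_mul f g : {malg R[G]} :=
  \sum_(k1 <- msupp f) \sum_(k2 <- msupp g) << f@_k1 * g@_k2 *g (k1 * k2)%g >>.

Local Open Scope fset_scope.

Lemma mring_mulEw (d1 d2 : {fset G}) f g :
    msupp f `<=` d1 -> msupp g `<=` d2 ->
  mring_mul f g =
    \sum_(k1 <- d1) \sum_(k2 <- d2) << f@_k1 * g@_k2 *g (k1 * k2)%g >>.
Proof.
move=> le_d1 le_d2; rewrite /mring_mul (big_fset_incl _ le_d1) /=.
  apply/eq_bigr=> k1 _; apply/big_fset_incl => // k _ /mcoeff_outdom ->.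
  by rewrite mulr0 monalgU0.
move=> k _ /mcoeff_outdom f_k.
by rewrite big1 => // k' _; rewrite f_k mul0r monalgU0.
Qed.

Lemma mring_mulUU (c1 c2 : R) (k1 k2 : G) :
  mring_mul << c1 *g k1 >> << c2 *g k2 >> = << c1 * c2 *g (k1 * k2)%g >>.
Proof. by rewrite (mring_mulEw msuppU_le msuppU_le) !big_seq_fset1 !mcoeffUU. Qed.

Lemma mring_mulDl : left_distributive mring_mul +%R.
Proof.
move=> f1 f2 g; have sub := fsubset_refl (msupp g).
rewrite (mring_mulEw (msuppD_le f1 f2) sub).
rewrite (mring_mulEw (fsubsetUl (msupp f1) (msupp f2)) sub).
rewrite (mring_mulEw (fsubsetUr (msupp f1) (msupp f2)) sub).
rewrite -big_split /=; apply/eq_bigr=> k1 _.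
rewrite -big_split /=; apply/eq_bigr=> k2 _.
by rewrite mcoeffD mulrDl monalgUD.
Qed.

Lemma mring_mulDr : right_distributive mring_mul +%R.
Proof.
move=> f g1 g2; have sub := fsubset_refl (msupp f).
rewrite (mring_mulEw sub (msuppD_le g1 g2)).
rewrite (mring_mulEw sub (fsubsetUl (msupp g1) (msupp g2))).
rewrite (mring_mulEw sub (fsubsetUr (msupp g1) (msupp g2))).
rewrite -big_split /=; apply/eq_bigr=> k1 _.
rewrite -big_split /=; apply/eq_bigr=> k2 _.
by rewrite mcoeffD mulrDr monalgUD.
Qed.

Lemma mring_mul0g : left_zero 0 mring_mul.
Proof. by move=> g; rewrite /mring_mul msupp0 big_seq_fset0. Qed.

Lemma mring_mulg0 : right_zero 0 mring_mul.
Proof. by move=> f; rewrite /mring_mul msupp0 big1 // => k _; rewrite big_seq_fset0. Qed.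

Lemma mring_mul_suml (I : Type) (r : seq I) (F : I -> {malg R[G]}) g :
  mring_mul (\sum_(i <- r) F i) g = \sum_(i <- r) mring_mul (F i) g.
Proof.
exact: (big_morph (mring_mul^~ g) (fun _ _ => mring_mulDl _ _ _)
                                  (mring_mul0g _)).
Qed.

Lemma mring_mul_sumr (I : Type) (r : seq I) (F : I -> {malg R[G]}) f :
  mring_mul f (\sum_(i <- r) F i) = \sum_(i <- r) mring_mul f (F i).
Proof.
exact: (big_morph (mring_mul f) (fun _ _ => mring_mulDr _ _ _)
                                (mring_mulg0 _)).
Qed.

Lemma mring_mul1g : left_id mring_one mring_mul.
Proof.
move=> g; rewrite [g in LHS]monalgE mring_mul_sumr [RHS]monalgE.
by apply/eq_bigr=> k _; rewrite mring_mulUU mul1r mul1g.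
Qed.

Lemma mring_mulg1 : right_id mring_one mring_mul.
Proof.
move=> f; rewrite [f in LHS]monalgE mring_mul_suml [RHS]monalgE.
by apply/eq_bigr=> k _; rewrite mring_mulUU mulr1 mulg1.
Qed.

Lemma mring_mulA : associative mring_mul.
Proof.
move=> f g h; rewrite [f]monalgE !mring_mul_suml; apply/eq_bigr=> k1 _.
rewrite [g]monalgE !(mring_mul_suml, mring_mul_sumr).
apply/eq_bigr=> k2 _; rewrite [h]monalgE !mring_mul_sumr.
by apply/eq_bigr=> k3 _; rewrite !mring_mulUU mulrA mulgA.
Qed.

HB.instance Definition _ := GRing.Zmodule_isPzRing.Build (monoid_ring R G)
  mring_mulA mring_mul1g mring_mulg1 mring_mulDl mring_mulDr.

End MonoidRing.

(* Main.v *)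
(* The coefficient of [f * g] at the least element [m] of the support of [g]
   is [f@_1 * g@_m], because [k1 * k2 > k2] when [k1 > 1]. Hence the coefficient
   at [1] is a ring morphism, and an idempotent of [R[G]] with zero coefficient
   at [1] vanishes. If [e] is an idempotent of [R[G]] and [r(e_1 R) = c R], then
   [c] is left semicentral, so [e c] is an idempotent with coefficient
   [e_1 c = 0] at [1]; thus [e c = 0] and [c R[G]] is contained in [r(e R[G])].
   Conversely, if [a] is in [r(e R[G])], so is [(1 - c) a]; its lowest
   coefficient would lie in [r(e_1 R) = c R] and be killed by [c], so
   [a = c a]. *)
Require Import Defs.
From mathcomp Require Import all_boot all_order all_algebra.
From mathcomp Require Import finmap classical_sets monalg.

Set Implicit Arguments.
Unset Strict Implicit.
Unset Printing Implicit Defensive.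

Import Order.TTheory GRing.Theory.

Local Open Scope ring_scope.

(** As [c] is idempotent, [a] lies in [c R] exactly when [c * a = a]; the equality of sets becomes
    an equivalence of equations. *)
Lemma right_annihilator_principalP (R : pzRingType) (e c : R) : c * c = c ->
  right_annihilator (principal_right_ideal e) = principal_right_ideal c <->
  (forall a, (forall r, e * r * a = 0) <-> c * a = a).
Proof.
move=> cc.
have annP a : right_annihilator (principal_right_ideal e) a <->
    forall r, e * r * a = 0.
  by split=> [ann r | ann _ [r _ <-]]; apply: ann; exists r.
have idP a : principal_right_ideal c a <-> c * a = a.
  by split=> [[r _ <-] | <-]; [rewrite mulrA cc | exists a].
split=> [eq_ann a | ann_c]; first by rewrite -annP eq_ann idP.
by apply/seteqP; split=> a; rewrite annP idP ann_c.
Qed.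

Section MonoidRingCoefficients.
Variables (R : pzRingType) (G : monoidType).
Implicit Types (f g : monoid_ring R G) (k : G) (r : R).

Definition mring_coeff k f : R := @mcoeff G R k f.

Definition mring_const r : monoid_ring R G := << r *g 1%g >>.

Lemma mring_coeffP f g :
  (forall k, mring_coeff k f = mring_coeff k g) <-> f = g.
Proof. exact: malgP. Qed.

Lemma mring_coeff0 k : mring_coeff k 0 = 0.
Proof. exact: mcoeff0. Qed.

Lemma mring_coeffU r k k' :
  mring_coeff k' (<< r *g k >> : monoid_ring R G) = r *+ (k == k').
Proof. exact: mcoeffU. Qed.

Lemma mring_coeff_sum (I : Type) (s : seq I) (F : I -> monoid_ring R G) k :
  mring_coeff k (\sum_(i <- s) F i) = \sum_(i <- s) mring_coeff k (F i).
Proof. exact: (raddf_sum (@mcoeff G R k)). Qed.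

Lemma mring_coeffE f k :
  \sum_(k1 <- msupp f) mring_coeff k1 f *+ (k1 == k) = mring_coeff k f.
Proof.
rewrite [f in RHS]monalgE mring_coeff_sum.
by apply: eq_bigr => k1 _; rewrite mring_coeffU.
Qed.

Lemma mring_coeffM k f g :
  mring_coeff k (f * g) = \sum_(k1 <- msupp f) \sum_(k2 <- msupp g)
    mring_coeff k1 f * mring_coeff k2 g *+ ((k1 * k2)%g == k).
Proof.
rewrite mring_coeff_sum; apply: eq_bigr => k1 _.
by rewrite mring_coeff_sum; apply: eq_bigr => k2 _; rewrite mring_coeffU.
Qed.

Lemma mring_coeff_constM k r f :
  mring_coeff k (mring_const r * f) = r * mring_coeff k f.
Proof.
rewrite [_ * f](mring_mulEw msuppU_le (fsubset_refl (msupp f))).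
rewrite big_seq_fset1 mring_coeff_sum -[in RHS]mring_coeffE mulr_sumr.
by apply: eq_bigr => i _; rewrite mring_coeffU mcoeffUU mul1g mulrnAr.
Qed.

Lemma mring_coeffM_const k r f :
  mring_coeff k (f * mring_const r) = mring_coeff k f * r.
Proof.
rewrite [f * _](mring_mulEw (fsubset_refl (msupp f)) msuppU_le).
rewrite mring_coeff_sum -[in RHS]mring_coeffE mulr_suml.
apply: eq_bigr => i _.
by rewrite big_seq_fset1 mring_coeffU mcoeffUU mulg1 mulrnAl.
Qed.

Lemma mring_constM r1 r2 :
  mring_const (r1 * r2) = mring_const r1 * mring_const r2.
Proof. by rewrite [RHS]mring_mulUU mulg1. Qed.

Lemma mring_coeff_const1 r : mring_coeff 1%g (mring_const r) = r.
Proof. by rewrite mring_coeffU eqxx. Qed.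

End MonoidRingCoefficients.

Section PositiveMonoidRing.
Variables (d : Order.disp_t) (R : pzRingType) (G : positiveMonoidType d).
Implicit Types (e f g : monoid_ring R G) (k m : G) (r c : R).

Lemma mring_coeffM_lowest m f g :
    (forall k, (k < m)%O -> mring_coeff k g = 0) ->
  mring_coeff m (f * g) = mring_coeff 1%g f * mring_coeff m g.
Proof.
move=> g_lt; rewrite mring_coeffM -[mring_coeff 1%g f]mring_coeffE mulr_suml.
apply: eq_bigr => k1 _; rewrite -[mring_coeff m g]mring_coeffE mulr_sumr.
apply: eq_bigr => k2 _; rewrite mulrnAl mulrnAr.
have [->|k1_neq1] := eqVneq k1 1%g; first by rewrite mul1g mulr1n.
(* If [k1 > 1] and [k1 * k2 = m], then [k2 < m], where [g] vanishes. *)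
rewrite mulr0n; case: eqP => // k12; rewrite [mring_coeff k2 g]g_lt ?mulr0 //.
have k1_gt1 : (1%g < k1)%O by rewrite lt_neqAle eq_sym k1_neq1 le1g.
by rewrite -k12 -{1}[k2]mul1g ltgM2r.
Qed.

Lemma mring_coeff1M f g :
  mring_coeff 1%g (f * g) = mring_coeff 1%g f * mring_coeff 1%g g.
Proof.
by apply: mring_coeffM_lowest => k; rewrite ltNge le1g.
Qed.

(** A nonzero [f] would have a least support element, the support being finite; the order on [G]
    need not be well-founded. *)
Lemma mring_lowest_eq0 f :
    (forall m, (forall k, (k < m)%O -> mring_coeff k f = 0) ->
      mring_coeff m f = 0) ->
  f = 0.
Proof.
move=> f_lowest.
have [f0|[k0 k0f]] := fset_0Vmem (msupp f).
  apply/mring_coeffP => k; rewrite mring_coeff0.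
  by apply: mcoeff_outdom; rewrite f0.
pose x0 : msupp f := [` k0f]%fset.
have [m _ m_min] := @arg_minP _ _ _ x0 xpredT (fun x => val x : G) isT.
have := fsvalP m; rewrite -mcoeff_neq0 => /eqP[].
apply: f_lowest => k k_lt; apply: mcoeff_outdom.
by apply/negP => kf; have := m_min [` kf]%fset isT; rewrite leNgt k_lt.
Qed.

(** If [e] vanishes below [m], then [e_m = (e * e)_m = e_1 * e_m = 0]. *)
Lemma mring_idempotent_eq0 e :
  e * e = e -> mring_coeff 1%g e = 0 -> e = 0.
Proof.
move=> ee e1; apply: mring_lowest_eq0 => m e_lt.
by rewrite -ee mring_coeffM_lowest // e1 mul0r.
Qed.

Lemma mring_annihilator e c :
    e * e = e -> c * c = c ->
    (forall a, (forall r, mring_coeff 1%g e * r * a = 0) <-> c * a = a) ->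
  forall a, (forall f, e * f * a = 0) <-> mring_const G c * a = a.
Proof.
move=> ee cc ann_c; set C := mring_const G c.
have e1r_c r : mring_coeff 1%g e * r * c = 0 by apply: (ann_c c).2.
(* [r * c] is again annihilated by [e_1 R], hence fixed by [c]. *)
have c_semicentral r : c * (r * c) = r * c.
  by apply: (ann_c _).1 => s; rewrite mulrA -(mulrA _ s) e1r_c.
have C_semicentral f : C * (f * C) = f * C.
  apply/mring_coeffP => k.
  by rewrite mring_coeff_constM mring_coeffM_const c_semicentral.
have eC : e * C = 0.
  apply: mring_idempotent_eq0.
    by rewrite -mulrA C_semicentral mulrA ee.
  by rewrite mring_coeffM_const -[X in X * c]mulr1 e1r_c.
move=> a; split=> [ann_a | <- f]; last first.
  (* Here [e * f * (C * a) = e * (C * (f * C)) * a], and [e * C = 0]. *)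
  by rewrite -mulrA (mulrA f) -C_semicentral 2!mulrA eC !mul0r.
apply/esym/subr0_eq.
have CC : C * C = C by rewrite -mring_constM cc.
have ann_b f : e * f * (a - C * a) = 0.
  by rewrite mulrBr ann_a mulrA -(mulrA e) ann_a subrr.
apply: mring_lowest_eq0 => m b_lt.
(* Testing the annihilation on constants [r] gives [e_1 * r * b_m = 0] for [b = a - C * a], so [c]
   fixes [b_m]; but [C * b = 0]. *)
have <- : c * mring_coeff m (a - C * a) = mring_coeff m (a - C * a).
  apply/ann_c => r; have := congr1 (mring_coeff m) (ann_b (mring_const G r)).
  by rewrite mring_coeffM_lowest // mring_coeffM_const mring_coeff0.
by rewrite -mring_coeff_constM mulrBr mulrA CC subrr mring_coeff0.
Qed.

End PositiveMonoidRing.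

Theorem theorem2p20 (d : Order.disp_t) (R : pzRingType)
    (G : positiveMonoidType d) :
  right_cP_Baer R <-> right_cP_Baer (monoid_ring R G).
Proof.
split=> [baerR e ee | baerRG e ee].
  have e1e1 : mring_coeff 1%g e * mring_coeff 1%g e = mring_coeff 1%g e.
    by rewrite -mring_coeff1M ee.
  have [c [cc /(right_annihilator_principalP _ cc) ann_c]] := baerR _ e1e1.
  have CC : mring_const G c * mring_const G c = mring_const G c.
    by rewrite -mring_constM cc.
  exists (mring_const G c); split=> //.
  by apply/(right_annihilator_principalP _ CC); apply: mring_annihilator.
(* For the converse, view [e] as a constant of [R[G]]; the coefficient at [1] of the idempotent [c]
   found there generates the annihilator in [R]. *)
have EE : mring_const G e * mring_const G e = mring_const G e.
  by rewrite -mring_constM ee.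
have [c [cc /(right_annihilator_principalP _ cc) ann_c]] := baerRG _ EE.
have c1c1 : mring_coeff 1%g c * mring_coeff 1%g c = mring_coeff 1%g c.
  by rewrite -mring_coeff1M cc.
exists (mring_coeff 1%g c); split=> //.
apply/(right_annihilator_principalP _ c1c1) => a; split=> [ann_a | <- r].
  have /ann_c /(congr1 (mring_coeff 1%g)) :
      forall f, mring_const G e * f * mring_const G a = 0.
    move=> f; apply/mring_coeffP => k.
    by rewrite mring_coeffM_const mring_coeff_constM ann_a mring_coeff0.
  by rewrite mring_coeffM_const mring_coeff_const1.
(* Taking coefficients at [1] in [e * r * c = 0] gives [e * r * c_1 = 0] in [R]. *)
have /(_ (mring_const G r)) := (ann_c c).2 cc.
move/(congr1 (mring_coeff 1%g)); rewrite mring_coeff0 !mring_coeff1M.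
by rewrite !mring_coeff_const1 mulrA => ->; rewrite mul0r.
Qed.
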